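(* Let $K$ be a field of characteristic $0$ and let $A=\sum_{n\ge1}a_nX^n\in K[[X]]$ be a formal series without constant term. For each commutative associative (nonunital) $K$-algebra $V$ consider the map $\phi_A:T(V)\to T(V)$. Write $Sh(V)$ for the Hopf algebra $T(V)$ with shuffle product and deconcatenation coproduct, and $QS(V)$ for the Hopf algebra $T(V)$ with quasi-shuffle product and deconcatenation coproduct. Then: 1. $\phi_A:Sh(V)\to Sh(V)$ is a Hopf algebra morphism for every commutative algebra $V$ if and only if $A=aX$ for some $a\in K$. 2. $\phi_A:Sh(V)\to QS(V)$ is a Hopf algebra morphism for every commutative algebra $V$ if and only if $A=\exp(aX)-1$ for some $a\in K$. 3. $\phi_A:QS(V)\to QS(V)$ is a Hopf algebra morphism for every commutative algebra $V$ if and only if $A=(1+X)^a-1$ for some $a\in K$. 4. $\phi_A:QS(V)\to Sh(V)$ is a Hopf algebra morphism for every commutative algebra $V$ if and only if $A=a\ln(1+X)$ for some $a\in K$.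
   Context: $T(V)=\bigoplus_{n\ge0}V^{\otimes n}$, elements $x_1\cdots x_n=x_1\otimes\cdots\otimes x_n$ are called words. The quasi-shuffle product $\star$ is defined inductively by $1\star v=v\star1=v$ and, for $a,b\in V$ and words $v,w$, $av\star bw=a(v\star bw)+b(av\star w)+(a\cdot b)(v\star w)$, where $a\cdot b$ is the product of $V$; the shuffle product is given by the same recursion without the last term. The coproduct is deconcatenation $\Delta(x_1\cdots x_n)=\sum_{i=0}^nx_1\cdots x_i\otimes x_{i+1}\cdots x_n$. $\phi_A$ is the unique (counital) coalgebra endomorphism of $(T(V),\Delta)$ such that $\pi\circ\phi_A=f_A$, where $\pi:T(V)\to V$ is the canonical projection and $f_A:T(V)\to V$ is the linear map with $f_A(1)=0$ and $f_A(x_1\cdots x_n)=a_n\,(x_1\cdots x_n)_V$, where $(y_1\cdots y_j)_V$ denotes the product in $V$. Explicitly $\phi_A(1)=1$ and, for $n\geq 1$, $\phi_A(x_1\cdots x_n)=\sum_{m=1}^n\sum_{i_1+\cdots+i_m=n,\ i_j\ge1}a_{i_1}\cdots a_{i_m}\,(x_1\cdots x_{i_1})_V\otimes\cdots\otimes(x_{i_1+\cdots+i_{m-1}+1}\cdots x_n)_V$. Also $(1+X)^a:=\exp(a\ln(1+X))$. *)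

(* Defs.v *)
From HB Require Import structures.
From mathcomp Require Import all_boot all_algebra.
From mathcomp.multinomials Require Import freeg.
From mathcomp.classical Require Import boolp.

Set Implicit Arguments.
Unset Strict Implicit.
Unset Printing Implicit Defensive.

Import GRing.Theory.
Local Open Scope ring_scope.
Local Open Scope quotient_scope.

Section LinearMaps.
Variables (K : fieldType) (U W : lmodType K) (f : U -> W).
Hypothesis fl : linear f.

Lemma linmap0 : f 0 = 0.
Proof. by have := fl (-1) 0 0; rewrite !scaleN1r !addNr. Qed.
Lemma linmapD : {morph f : x y / x + y}.
Proof. by move=> x y; have := fl 1 x y; rewrite !scale1r. Qed.
Lemma linmapZ c : {morph f : x / c *: x}.
Proof. by move=> x; have := fl c x 0; rewrite linmap0 !addr0. Qed.
Lemma linmapB : {morph f : x y / x - y}.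
Proof. by move=> x y; rewrite addrC -scaleN1r fl scaleN1r addrC. Qed.
Lemma linmap_sum I (r : seq I) (P : pred I) E :
  f (\sum_(i <- r | P i) E i) = \sum_(i <- r | P i) f (E i).
Proof. exact: (big_morph f linmapD linmap0). Qed.
End LinearMaps.

Section PresentedModule.
Variables (K : fieldType) (G : choiceType).
Local Notation F := {freeg G / K}.
Variable rel : F -> Prop.

(* The submodule spanned by rel. *)
Definition fspan (x : F) : Prop :=
  forall S : F -> Prop,
    S 0 -> (forall c u v, S u -> S v -> S (c *: u + v)) ->
    (forall r, rel r -> S r) -> S x.

Definition fspan_pred : {pred F} := fun x => `[< fspan x >].

Lemma fspan_lin c x y : fspan x -> fspan y -> fspan (c *: x + y).
Proof. by move=> xS yS S S0 SD Sr; apply: (SD); [exact: (xS S S0 SD Sr)|exact: (yS S S0 SD Sr)]. Qed.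

Lemma fspan0 : fspan 0. Proof. by move=> S S0 _ _; exact: S0. Qed.

Lemma fspan_rel r : rel r -> fspan r.
Proof. by move=> rr S S0 SD Sr; exact: Sr. Qed.

Lemma fspan_zmod : zmod_closed fspan_pred.
Proof.
split=> [|x y /asboolP xS /asboolP yS]; apply/asboolP; first exact: fspan0.
by rewrite addrC -scaleN1r; exact: fspan_lin.
Qed.

HB.instance Definition _ := GRing.isZmodClosed.Build F fspan_pred fspan_zmod.

(* The K-module with generators G and relations r = 0 for rel r. *)
Definition presmod : Type := Quotient.quot fspan_pred.
HB.instance Definition _ := GRing.Zmodule.on presmod.
HB.instance Definition _ := ZmodQuotient.on presmod.

Lemma pi_presmodP (x y : F) :
  fspan (x - y) <-> \pi_presmod x = \pi_presmod y.
Proof.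
split=> [h|/eqP]; first by apply/eqP; rewrite -Quotient.idealrBE; apply/asboolP.
by rewrite -Quotient.idealrBE => /asboolP.
Qed.

Definition pscale (c : K) (x : presmod) : presmod := \pi_presmod (c *: repr x).

Lemma pi_pscale c x : \pi_presmod (c *: x) = pscale c (\pi x).
Proof.
apply/pi_presmodP; rewrite -scalerBr -[_ *: _]addr0; apply: fspan_lin fspan0.
by apply/pi_presmodP; rewrite reprK.
Qed.

Lemma pscaleA a b x : pscale a (pscale b x) = pscale (a * b) x.
Proof. by elim/quotW: x => x; rewrite -[pscale b _]pi_pscale -!pi_pscale scalerA. Qed.
Lemma pscale1 : left_id 1 pscale.
Proof.
by elim/quotW=> x; rewrite -pi_pscale scale1r.
Qed.
Lemma pscaleDr : right_distributive pscale +%R.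
Proof.
move=> a; elim/quotW=> x; elim/quotW=> y.
by rewrite -raddfD -!pi_pscale -raddfD scalerDr.
Qed.
Lemma pscaleDl x : {morph pscale^~ x : a b / a + b}.
Proof. by elim/quotW: x => x a b; rewrite -!pi_pscale scalerDl raddfD. Qed.

HB.instance Definition _ := GRing.Zmodule_isLmodule.Build K presmod
  pscaleA pscale1 pscaleDr pscaleDl.

Lemma pi_presmod_linear : linear (\pi_presmod : F -> presmod).
Proof. by move=> c x y; rewrite raddfD /= pi_pscale. Qed.

Definition pgen (g : G) : presmod := \pi << g >>.

Section Lift.
Variables (W : lmodType K) (f : G -> W).

Lemma fglift_linear : linear (fglift f).
Proof.
have fD : {morph fglift f : x y / x + y}.
  have fB := lift_is_additive f => x y.
  have f0 : fglift f 0 = 0 by rewrite -(subrr 0) fB subrr.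
  have fN z : fglift f (- z) = - fglift f z by rewrite -[- z]sub0r fB f0 sub0r.
  by rewrite -{1}[y]opprK fB fN opprK.
have f0 : fglift f 0 = 0 by apply: (addrI (fglift f 0)); rewrite -fD !addr0.
move=> c x y; rewrite fD; congr (_ + _).
rewrite -[in LHS](freeg_sumE (c *: x)) -[in RHS](freeg_sumE x).
have fs (r : seq G) (E : G -> K) :
    fglift f (\sum_(z <- r) << E z *g z >>) = \sum_(z <- r) E z *: f z.
  by rewrite (big_morph _ fD f0); apply: eq_bigr => z _; rewrite liftU.
have -> : \sum_(z <- dom (c *: x)) << coeff z (c *: x) *g z >>
        = \sum_(z <- dom x) << c * coeff z x *g z >>.
  rewrite freeg_sumE; apply/eqP/freeg_eqP => k.
  by rewrite coeff_fgscale.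
rewrite !fs scaler_sumr; apply: eq_bigr => z _.
by rewrite scalerA.
Qed.

(* The map induced by f; meaningful only when f respects the relations
   (plift_pgen, plift_linear). *)
Definition plift (x : presmod) : W := fglift f (repr x).

Hypothesis fP : forall r, rel r -> fglift f r = 0.

Lemma plift_pi x : plift (\pi x) = fglift f x.
Proof.
apply/eqP; rewrite -subr_eq0 -(linmapB fglift_linear); apply/eqP.
have : fspan (repr (\pi_presmod x) - x) by apply/pi_presmodP; rewrite reprK.
move/(_ (fun z => fglift f z = 0)); apply=> [|c u v u0 v0|//]; first exact: linmap0 fglift_linear.
by rewrite fglift_linear u0 v0 scaler0 addr0.
Qed.

Lemma plift_linear : linear plift.
Proof.
move=> c x y; rewrite -[x]reprK -[y]reprK -pi_presmod_linear !plift_pi.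
exact: fglift_linear.
Qed.

Lemma plift_pgen g : plift (pgen g) = f g.
Proof. by rewrite plift_pi liftU scale1r. Qed.
End Lift.


Lemma presmod_sum (x : presmod) :
  x = \sum_(z <- dom (repr x)) coeff z (repr x) *: pgen z.
Proof.
rewrite -{1}[x]reprK -{1}(freeg_sumE (repr x)) raddf_sum /=.
apply: eq_bigr => z _; rewrite /pgen -[RHS]pi_pscale; congr (\pi_presmod _).
by apply/eqP/freeg_eqP => k; rewrite coeffZ !coeffU mul1r.
Qed.

Lemma presmod_ext (W : lmodType K) (f g : presmod -> W) :
  linear f -> linear g -> (forall x, f (pgen x) = g (pgen x)) -> f =1 g.
Proof.
move=> fl gl fg x; rewrite (presmod_sum x).
rewrite (linmap_sum fl) (linmap_sum gl); apply: eq_bigr => z _.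
by rewrite (linmapZ fl) (linmapZ gl) fg.
Qed.
End PresentedModule.

Section Tensor.
Variables (K : fieldType) (U W : lmodType K).

Inductive bilin_rel : {freeg (U * W)%type / K} -> Prop :=
| BilinL c x x' y :
    bilin_rel (<< (c *: x + x', y) >> - (c *: << (x, y) >> + << (x', y) >>))
| BilinR c x y y' :
    bilin_rel (<< (x, c *: y + y') >> - (c *: << (x, y) >> + << (x, y') >>)).

Definition tens : Type := presmod bilin_rel.
HB.instance Definition _ := GRing.Lmodule.on tens.

Definition tpair (x : U) (y : W) : tens := pgen bilin_rel (x, y).
End Tensor.

Notation "U *t W" := (tens U W) (at level 40, left associativity) : type_scope.
Notation "x *t y" := (tpair x y) (at level 40, left associativity) : ring_scope.

Section TensorTheory.
Variables (K : fieldType) (U W : lmodType K).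

Lemma tpair_linl (y : W) : linear (fun x : U => x *t y).
Proof.
move=> c x x'; rewrite /tpair /pgen -pi_presmod_linear; apply/pi_presmodP.
by apply: fspan_rel; apply: BilinL.
Qed.

Lemma tpair_linr (x : U) : linear (fun y : W => x *t y).
Proof.
move=> c y y'; rewrite /tpair /pgen -pi_presmod_linear; apply/pi_presmodP.
by apply: fspan_rel; apply: BilinR.
Qed.

Section Lift.
Variables (Z : lmodType K) (f : U -> W -> Z).
Hypotheses (fl : forall y, linear (f ^~ y)) (fr : forall x, linear (f x)).

Lemma bilin_relP r : bilin_rel r -> fglift (fun p => f p.1 p.2) r = 0.
Proof.
have lin := fglift_linear (fun p : U * W => f p.1 p.2).
by case=> [c x x' y|c x y y'];
  rewrite (linmapB lin) lin !liftU /= !scale1r ?fl ?fr subrr.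
Qed.
End Lift.
End TensorTheory.

Section TensorMap.
Variables (K : fieldType) (U W U' W' : lmodType K).
Variables (f : U -> U') (g : W -> W').

Definition tmap : U *t W -> U' *t W' := plift (fun p => f p.1 *t g p.2).

Hypotheses (fl : linear f) (gl : linear g).

Lemma tmap_relP r : bilin_rel r -> fglift (fun p : U * W => f p.1 *t g p.2) r = 0.
Proof.
apply: (bilin_relP (f := fun x y => f x *t g y)) => [y|x] c u v.
  by rewrite fl tpair_linl.
by rewrite gl tpair_linr.
Qed.

Lemma tmap_linear : linear tmap.
Proof. exact: plift_linear tmap_relP. Qed.

Lemma tmapE x y : tmap (x *t y) = f x *t g y.
Proof. exact: plift_pgen tmap_relP _. Qed.
End TensorMap.

Section TensorAlgebra.
Variables (K : fieldType) (V : lmodType K).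

Inductive multilin_rel : {freeg (seq V) / K} -> Prop :=
| MultilinRel s t c x y :
    multilin_rel (<< s ++ (c *: x + y) :: t >>
                  - (c *: << s ++ x :: t >> + << s ++ y :: t >>)).

(* T(V): the relations are homogeneous for the length of words, so this is the
   direct sum of the tensor powers V^(ox n); the empty word is the unit. *)
Definition tensalg : Type := presmod multilin_rel.
HB.instance Definition _ := GRing.Lmodule.on tensalg.

Definition word (s : seq V) : tensalg := pgen multilin_rel s.

Definition multilinear (W : lmodType K) (f : seq V -> W) : Prop :=
  forall s t c x y,
    f (s ++ (c *: x + y) :: t) = c *: f (s ++ x :: t) + f (s ++ y :: t).

Lemma word_multilinear : multilinear word.
Proof.
move=> s t c x y; rewrite /word /pgen -pi_presmod_linear; apply/pi_presmodP.
by apply: fspan_rel; apply: MultilinRel.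
Qed.

(* The linear map extending f from words to T(V); meaningful only for
   multilinear f (tlift_word, tlift_linear). *)
Definition tlift (W : lmodType K) (f : seq V -> W) : tensalg -> W := plift f.

Section Lift.
Variables (W : lmodType K) (f : seq V -> W).
Hypothesis fm : multilinear f.

Lemma multilin_relP r : multilin_rel r -> fglift f r = 0.
Proof.
have lin := fglift_linear f.
by case=> s t c x y; rewrite (linmapB lin) lin !liftU /= !scale1r fm subrr.
Qed.

Lemma tlift_linear : linear (tlift f).
Proof. exact: plift_linear multilin_relP. Qed.

Lemma tlift_word s : tlift f (word s) = f s.
Proof. exact: plift_pgen multilin_relP _. Qed.
End Lift.

Lemma tensalg_ext (W : lmodType K) (f g : tensalg -> W) :
  linear f -> linear g -> (forall s, f (word s) = g (word s)) -> f =1 g.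
Proof. exact: presmod_ext. Qed.

Definition tcons (a : V) : tensalg -> tensalg := tlift (fun s => word (a :: s)).

Lemma tcons_multilinear a : multilinear (fun s => word (a :: s)).
Proof. by move=> s; exact: (word_multilinear (a :: s)). Qed.

Lemma tcons_linear a : linear (tcons a).
Proof. exact/tlift_linear/tcons_multilinear. Qed.

Lemma tcons_word a s : tcons a (word s) = word (a :: s).
Proof. by rewrite [LHS]tlift_word //; exact: tcons_multilinear. Qed.

Lemma tcons_linl u : linear (tcons ^~ u).
Proof.
move=> c x y /=; move: u; apply: tensalg_ext; first exact: tcons_linear.
  move=> d u v; rewrite !tcons_linear !scalerDr !scalerA mulrC -!addrA.
  by congr (_ + _); rewrite addrCA.
by move=> s; rewrite !tcons_word; exact: (word_multilinear [::]).
Qed.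

Definition decat (s : seq V) : tensalg *t tensalg :=
  \sum_(i < (size s).+1) word (take i s) *t word (drop i s).

Definition deconc : tensalg -> tensalg *t tensalg := tlift decat.

Definition tcounit : tensalg -> K := tlift (fun s => (s == [::])%:R : K^o).

Definition tproj : tensalg -> V := tlift (fun s => if s is [:: x] then x else 0).

Lemma decat_multilinear : multilinear decat.
Proof.
move=> s t c x y; rewrite /decat !size_cat /= scaler_sumr -big_split /=.
apply: eq_bigr => i _; rewrite !take_cat !drop_cat; case: ltnP => [_|le_si].
  by rewrite word_multilinear tpair_linr.
case: (i - size s)%N => [|n] /=; last by rewrite word_multilinear tpair_linl.
by rewrite (word_multilinear [::]) tpair_linr.
Qed.

Lemma deconc_linear : linear deconc.
Proof. exact/tlift_linear/decat_multilinear. Qed.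

Lemma deconc_word s : deconc (word s) = decat s.
Proof. exact/tlift_word/decat_multilinear. Qed.

Lemma tcounit_multilinear :
  multilinear (fun s => (s == [::])%:R : K^o).
Proof. by move=> [|z s] t c x y /=; rewrite scaler0 addr0. Qed.

Lemma tcounit_linear : linear (tcounit : _ -> K^o).
Proof. exact/tlift_linear/tcounit_multilinear. Qed.

Lemma tcounit_word s : tcounit (word s) = (s == [::])%:R.
Proof. by rewrite [LHS]tlift_word //; exact: tcounit_multilinear. Qed.

Lemma tproj_multilinear :
  multilinear (fun s => if s is [:: x] then x else 0 : V).
Proof. by move=> [|z [|z' s]] [|z'' t] c x y //=; rewrite scaler0 addr0. Qed.

Lemma tproj_linear : linear tproj.
Proof. exact/tlift_linear/tproj_multilinear. Qed.

Lemma tproj_word s : tproj (word s) = if s is [:: x] then x else 0.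
Proof. exact/tlift_word/tproj_multilinear. Qed.
End TensorAlgebra.

HB.mixin Record isComNonunitalAlgebra (K : fieldType) V of GRing.Lmodule K V := {
  dot : V -> V -> V;
  dotA : associative dot;
  dotC : commutative dot;
  dot_linear : forall y, linear (fun x => dot x y)
}.

#[short(type="comNonunitalAlgType")]
HB.structure Definition ComNonunitalAlgebra (K : fieldType) :=
  {V of isComNonunitalAlgebra K V & GRing.Lmodule K V}.

Section Products.
Variables (K : fieldType) (V : comNonunitalAlgType K).
Local Notation T := (tensalg V).

Lemma dot_linr (x : V) : linear (dot x).
Proof. by move=> c y z; rewrite ![dot x _]dotC dot_linear. Qed.

(* Products of words; the nested fixpoint gives the recursion in the second
   argument (shwE, qshwE). *)
Fixpoint shw (s : seq V) : seq V -> T :=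
  if s is a :: v then
    fix shw_s t := if t is b :: w
      then tcons a (shw v t) + tcons b (shw_s w)
      else word (a :: v)
  else fun t => word t.

Fixpoint qshw (s : seq V) : seq V -> T :=
  if s is a :: v then
    fix qshw_s t := if t is b :: w
      then tcons a (qshw v t) + tcons b (qshw_s w) + tcons (dot a b) (qshw v w)
      else word (a :: v)
  else fun t => word t.

Definition shuffle (x y : T) : T := tlift (fun s => tlift (shw s) y) x.
Definition qshuffle (x y : T) : T := tlift (fun s => tlift (qshw s) y) x.

Lemma shw_nil s : shw s [::] = word s. Proof. by case: s. Qed.
Lemma qshw_nil s : qshw s [::] = word s. Proof. by case: s. Qed.

Lemma shwE a v b w :
  shw (a :: v) (b :: w) = tcons a (shw v (b :: w)) + tcons b (shw (a :: v) w).
Proof. by []. Qed.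

Lemma qshwE a v b w :
  qshw (a :: v) (b :: w) = tcons a (qshw v (b :: w)) + tcons b (qshw (a :: v) w)
                           + tcons (dot a b) (qshw v w).
Proof. by []. Qed.

Lemma shwC s t : shw s t = shw t s.
Proof.
elim: s t => [|a v IHs] t; first by rewrite shw_nil.
elim: t => [|b w IHt]; first by rewrite shw_nil.
by rewrite !shwE IHs IHt addrC.
Qed.

Lemma qshwC s t : qshw s t = qshw t s.
Proof.
elim: s t => [|a v IHs] t; first by rewrite qshw_nil.
elim: t => [|b w IHt]; first by rewrite qshw_nil.
by rewrite !qshwE !IHs IHt dotC [in RHS](addrC (tcons b _)).
Qed.

Lemma lin2 (W : lmodType K) (c : K) (p q p' q' : W) :
  c *: p + p' + (c *: q + q') = c *: (p + q) + (p' + q').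
Proof. by rewrite scalerDr addrACA. Qed.

Lemma shw_multilinear t : multilinear (shw ^~ t).
Proof.
move=> s s' c x y; elim: s t => [|a v IHs] t; rewrite ?cat0s ?cat_cons.
  elim: t => [|b w IHt]; first by rewrite !shw_nil; exact: (word_multilinear [::]).
  by rewrite !shwE IHt !tcons_linear tcons_linl !lin2.
elim: t => [|b w IHt]; first by rewrite !shw_nil; exact: (word_multilinear (a :: v)).
by rewrite !shwE !IHs IHt !tcons_linear !lin2.
Qed.

Lemma qshw_multilinear t : multilinear (qshw ^~ t).
Proof.
move=> s s' c x y; elim: s t => [|a v IHs] t; rewrite ?cat0s ?cat_cons.
  elim: t => [|b w IHt]; first by rewrite !qshw_nil; exact: (word_multilinear [::]).
  by rewrite !qshwE IHt !tcons_linear dot_linear !tcons_linl !lin2.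
elim: t => [|b w IHt]; first by rewrite !qshw_nil; exact: (word_multilinear (a :: v)).
by rewrite !qshwE !IHs IHt !tcons_linear !lin2.
Qed.

Section Bilinear.
Variable h : seq V -> seq V -> T.
Hypotheses (hC : forall s t, h s t = h t s) (hm : forall t, multilinear (h ^~ t)).

Let hmr s : multilinear (h s).
Proof. by move=> t t' c x y; rewrite !(hC s) hm. Qed.

Lemma tlift2_multilinear y : multilinear (fun s => tlift (h s) y).
Proof.
move=> s s' c x x'; move: y; apply: tensalg_ext; first exact: tlift_linear.
  by move=> d u v; rewrite !(tlift_linear (hmr _)) !scalerDr !scalerA (mulrC d) addrACA.
by move=> t; rewrite !tlift_word //; exact: hm.
Qed.

Lemma tlift2_linl y : linear (fun x => tlift (fun s => tlift (h s) y) x).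
Proof. exact/tlift_linear/tlift2_multilinear. Qed.

Lemma tlift2_linr x : linear (fun y => tlift (fun s => tlift (h s) y) x).
Proof.
move=> c y y'; move: x; apply: tensalg_ext; first exact: tlift2_linl.
  by move=> d u v; rewrite !tlift2_linl !scalerDr !scalerA (mulrC d) addrACA.
move=> s; rewrite !(tlift_word (tlift2_multilinear _)).
exact: tlift_linear.
Qed.

Lemma tlift2_word s t : tlift (fun s => tlift (h s) (word t)) (word s) = h s t.
Proof. by rewrite (tlift_word (tlift2_multilinear _)) tlift_word. Qed.
End Bilinear.

Lemma shuffle_linl y : linear (shuffle ^~ y).
Proof. exact: tlift2_linl shwC shw_multilinear y. Qed.
Lemma shuffle_linr x : linear (shuffle x).
Proof. exact: tlift2_linr shwC shw_multilinear x. Qed.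
Lemma shuffle_word s t : shuffle (word s) (word t) = shw s t.
Proof. exact: tlift2_word shwC shw_multilinear s t. Qed.

Lemma qshuffle_linl y : linear (qshuffle ^~ y).
Proof. exact: tlift2_linl qshwC qshw_multilinear y. Qed.
Lemma qshuffle_linr x : linear (qshuffle x).
Proof. exact: tlift2_linr qshwC qshw_multilinear x. Qed.
Lemma qshuffle_word s t : qshuffle (word s) (word t) = qshw s t.
Proof. exact: tlift2_word qshwC qshw_multilinear s t. Qed.

(* (y_1 ... y_j)_V; the value on the empty word is junk. *)
Definition dotprod (s : seq V) : V := if s is x :: s' then foldl dot x s' else 0.

Lemma dotprod_linear s t c x y :
  dotprod (s ++ (c *: x + y) :: t)
  = c *: dotprod (s ++ x :: t) + dotprod (s ++ y :: t).
Proof.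
have foldl_lin r d u v :
    foldl dot (d *: u + v) r = d *: foldl dot u r + foldl dot v r.
  by elim: r u v => //= z r IH u v; rewrite dot_linear IH.
case: s => [|z s] /=; first exact: foldl_lin.
by rewrite !foldl_cat /= dot_linr foldl_lin.
Qed.

(* A composition (i_1, ..., i_m) of n = size s is an m-tuple of positive
   integers of sum n; reshape i s cuts s into its consecutive blocks. For the
   empty word only m = 0 contributes, and for n >= 1 only m >= 1 does. *)
Definition phiw (a : nat -> K) (s : seq V) : T :=
  \sum_(m < (size s).+1)
    \sum_(i : m.-tuple 'I_(size s).+1 |
          all (fun k : 'I_(size s).+1 => 0 < k)%N i
          && (\sum_(k <- i) k == size s)%N)
      (\prod_(k <- i) a k)
        *: word [seq dotprod b | b <- reshape (map val i) s].

Definition phi (a : nat -> K) : T -> T := tlift (phiw a).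

Lemma reshape_multilinear sh s t c x y :
  sumn sh = size (s ++ x :: t) ->
  word [seq dotprod b | b <- reshape sh (s ++ (c *: x + y) :: t)]
  = c *: word [seq dotprod b | b <- reshape sh (s ++ x :: t)]
    + word [seq dotprod b | b <- reshape sh (s ++ y :: t)].
Proof.
elim: sh s => [|n sh IH] s /=; first by rewrite size_cat addnS.
rewrite size_cat /= addnS => eq_n.
rewrite !take_cat !drop_cat; case: ltnP => [lt_ns|le_sn].
  rewrite -!(tcons_word (dotprod _)) IH ?tcons_linear //.
  by apply: (@addnI n); rewrite eq_n size_cat /= size_drop addnS addnS addnA subnKC // ltnW.
case def_n: (n - size s)%N => [|k] /=.
  rewrite !cats0 -!(tcons_word (dotprod _)) (IH [::]) ?tcons_linear //=.
by move: eq_n; rewrite -[n](subnKC le_sn) def_n addn0 -addnS => /addnI.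
by rewrite dotprod_linear (word_multilinear [::]).
Qed.

Lemma phiw_multilinear a : multilinear (phiw a).
Proof.
move=> s t c x y; rewrite /phiw !size_cat /= scaler_sumr -big_split /=.
apply: eq_bigr => m _; rewrite scaler_sumr -big_split /=.
apply: eq_bigr => i /andP[_ /eqP sum_i].
rewrite reshape_multilinear ?scalerDr ?scalerA 1?mulrC //.
by rewrite sumnE big_map sum_i size_cat.
Qed.

Lemma phi_linear a : linear (phi a).
Proof. exact/tlift_linear/phiw_multilinear. Qed.

Lemma phi_word a s : phi a (word s) = phiw a s.
Proof. exact/tlift_word/phiw_multilinear. Qed.

Section Compositions.
Variable W : lmodType K.

Fixpoint csum (m n : nat) (F : seq nat -> W) : W :=
  if m is m'.+1 then \sum_(k < n) csum m' (n - k.+1) (fun l => F (k.+1 :: l))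
  else if n is 0 then F [::] else 0.

Lemma csumE m N n F : (n < N)%N ->
  \sum_(i : m.-tuple 'I_N | all (fun k : 'I_N => 0 < k)%N i
                            && (\sum_(k <- i) k == n)%N) F (map val i)
  = csum m n F.
Proof.
elim: m n F => [|m IH] n F lt_nN /=.
  case: n lt_nN => [|n] lt_nN.
    rewrite (big_pred1 [tuple]) // => i.
    by rewrite (tuple0 i) /= big_nil; apply/esym/eqP.
  by rewrite big_pred0 // => i; rewrite tuple0 /= big_nil.
rewrite (reindex (fun p : 'I_N * m.-tuple 'I_N => cons_tuple p.1 p.2)) /=; last first.
  exists (fun i : m.+1.-tuple 'I_N => (thead i, [tuple of behead i])) => [[k t]|i] _ /=.
    by congr (_, _); apply: val_inj.
  by rewrite [RHS]tuple_eta; apply: val_inj.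
pose G (k : nat) := if (0 < k <= n)%N then csum m (n - k) (fun l => F (k :: l)) else 0.
transitivity (\sum_(k < N) G k).
  rewrite -(pair_big_dep xpredT
    (fun (k : 'I_N) (t : m.-tuple 'I_N) => (0 < k)%N && all (fun k : 'I_N => 0 < k)%N t
       && (\sum_(j <- k :: t) j == n)%N)
    (fun k t => F (val k :: map val t))) /=.
  apply: eq_bigr => k _; rewrite /G; case: ltnP => [k0|] /=; last by rewrite big_pred0.
  case: leqP => [le_kn|lt_nk].
    rewrite -IH; last exact: leq_ltn_trans (leq_subr _ _) lt_nN.
    by apply: eq_bigl => t; rewrite big_cons -(eqn_add2l k (\sum_(j <- t) _)) subnKC.
  rewrite big_pred0 // => t; rewrite big_cons; apply/negbTE.
  by rewrite negb_and neq_ltn (leq_trans lt_nk (leq_addr _ _)) !orbT.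
case: N lt_nN {IH} => // N; rewrite ltnS => le_nN.
rewrite big_ord_recl {1}/G /= add0r.
rewrite (big_ord_widen N (fun k => csum m (n - k.+1) (fun l => F (k.+1 :: l))) le_nN).
by rewrite [RHS]big_mkcond.
Qed.

Lemma csum_gt m n F : (n < m)%N -> csum m n F = 0.
Proof.
elim: m n F => // m IH n F; rewrite ltnS => le_nm /=.
apply: big1 => k _; apply: IH; apply: leq_trans le_nm.
by rewrite ltn_subrL (leq_ltn_trans _ (ltn_ord k)).
Qed.
End Compositions.

Section PhiRec.
Variable a : nat -> K.

Let F s (l : seq nat) : T :=
  (\prod_(k <- l) a k) *: word [seq dotprod b | b <- reshape l s].

Lemma phiw_csum s : phiw a s = \sum_(m < (size s).+1) csum m (size s) (F s).
Proof.
apply: eq_bigr => m _; rewrite -(csumE _ (F s) (ltnSn (size s))).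
by apply: eq_bigr => i _; rewrite /F big_map.
Qed.

Lemma csum_lin (W W' : lmodType K) (f : W -> W') m n (E : seq nat -> W) :
  linear f -> f (csum m n E) = csum m n (f \o E).
Proof.
move=> fl; elim: m n E => [|m IH] n E /=; first by case: n => //; rewrite (linmap0 fl).
by rewrite (linmap_sum fl); apply: eq_bigr => k _; rewrite IH.
Qed.

Lemma eq_csum (W : lmodType K) m n (E E' : seq nat -> W) :
  E =1 E' -> csum m n E = csum m n E'.
Proof.
elim: m n E E' => [|m IH] n E E' eqE /=; first by rewrite eqE.
by apply: eq_bigr => k _; apply: IH => l; exact: eqE.
Qed.

Lemma phiw_nil : phiw a [::] = word [::].
Proof. by rewrite phiw_csum big_ord1 /= /F big_nil scale1r. Qed.

Lemma phiw_rec s : (0 < size s)%N ->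
  phiw a s = \sum_(k < size s)
    a k.+1 *: tcons (dotprod (take k.+1 s)) (phiw a (drop k.+1 s)).
Proof.
move=> s0; rewrite phiw_csum big_ord_recl /= -[X in if X is 0 then _ else _]prednK //= add0r.
rewrite exchange_big /=; apply: eq_bigr => k _.
rewrite phiw_csum (linmap_sum (tcons_linear _)) scaler_sumr size_drop.
pose f (u : T) := a k.+1 *: tcons (dotprod (take k.+1 s)) u.
have fl : linear f by move=> c u v; rewrite /f tcons_linear scalerDr !scalerA mulrC.
transitivity (\sum_(m < size s) f (csum m (size s - k.+1) (F (drop k.+1 s)))).
  apply: eq_bigr => m _; rewrite (csum_lin _ _ _ fl); apply: eq_csum => l /=.
  by rewrite /f /F /= big_cons (linmapZ (tcons_linear _)) tcons_word scalerA.
have le : ((size s - k.+1).+1 <= size s)%N by rewrite ltn_subrL.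
rewrite (big_ord_widen _ (fun m => f (csum m (size s - k.+1) (F (drop k.+1 s)))) le).
rewrite [RHS]big_mkcond /=; apply: eq_bigr => m _.
by case: ltnP => // lt; rewrite csum_gt // (linmap0 fl).
Qed.

Lemma deconc_tcons (x : V) (u : T) :
  deconc (tcons x u) = word [::] *t tcons x u + tmap (tcons x) id (deconc u).
Proof.
have idl : linear (@id T) by [].
have tl := tmap_linear (tcons_linear x) idl.
move: u; apply: tensalg_ext.
- by move=> c u v; rewrite tcons_linear deconc_linear.
- move=> c u v; rewrite tcons_linear tpair_linr deconc_linear tl.
  by rewrite scalerDr addrACA.
move=> s; rewrite tcons_word !deconc_word /decat big_ord_recl /=; congr (_ + _).
rewrite (linmap_sum tl); apply: eq_bigr => i _.
by rewrite (tmapE (tcons_linear _) idl) tcons_word.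
Qed.

Lemma tcounit_tcons (x : V) (u : T) : tcounit (tcons x u) = 0.
Proof.
move: u; apply: (@tensalg_ext _ _ K^o (fun u => tcounit (tcons x u)) (fun=> 0)).
- by move=> c u v; rewrite tcons_linear tcounit_linear.
- by move=> c u v; rewrite scaler0 addr0.
by move=> s; rewrite tcons_word tcounit_word.
Qed.

Lemma tproj_tcons (x : V) (u : T) : tproj (tcons x u) = tcounit u *: x.
Proof.
move: u; apply: tensalg_ext.
- by move=> c u v; rewrite tcons_linear tproj_linear.
- by move=> c u v; rewrite tcounit_linear scalerDl scalerA.
move=> s; rewrite tcons_word tproj_word tcounit_word.
by case: s => [|y s]; rewrite ?scale1r ?scale0r.
Qed.

Lemma tcounit_phiw s : tcounit (phiw a s) = (s == [::])%:R.
Proof.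
case: s => [|x s]; first by rewrite phiw_nil tcounit_word.
rewrite phiw_rec // (linmap_sum (W := K^o) (@tcounit_linear K V)) big1 // => k _.
by rewrite (linmapZ (W := K^o) (@tcounit_linear K V)) tcounit_tcons scaler0.
Qed.

(* phi a is the counital coalgebra endomorphism such that tproj \o phi a maps
   the word x_1 ... x_n to a_n *: (x_1 ... x_n)_V. *)
Lemma phi_counit u : tcounit (phi a u) = tcounit u.
Proof.
move: u; apply: (@tensalg_ext _ _ K^o (fun u => tcounit (phi a u)) (@tcounit K V)).
- by move=> c u v; rewrite phi_linear tcounit_linear.
- exact: tcounit_linear.
by move=> s; rewrite phi_word tcounit_phiw tcounit_word.
Qed.

Lemma phi_proj s :
  tproj (phi a (word s)) = if s is [::] then 0 else a (size s) *: dotprod s.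
Proof.
rewrite phi_word; case: s => [|x s]; first by rewrite phiw_nil tproj_word.
rewrite phiw_rec // (linmap_sum (@tproj_linear K V)) big_ord_recr big1 /= => [|k _].
  rewrite add0r (linmapZ (@tproj_linear K V)) tproj_tcons tcounit_phiw.
  by rewrite drop_size take_size eqxx scale1r.
rewrite (linmapZ (@tproj_linear K V)) tproj_tcons tcounit_phiw -size_eq0 size_drop.
by rewrite subn_eq0 leqNgt ltn_ord scale0r scaler0.
Qed.

Lemma phi_comul u : deconc (phi a u) = tmap (phi a) (phi a) (deconc u).
Proof.
have pl := phi_linear a; have ppl := tmap_linear pl pl.
move: u; apply: tensalg_ext.
- by move=> c u v; rewrite phi_linear deconc_linear.
- by move=> c u v; rewrite deconc_linear ppl.
move=> s; rewrite phi_word deconc_word (linmap_sum ppl).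
under eq_bigr do rewrite tmapE // !phi_word.
have [n] := ubnP (size s); elim: n s => // n IH s lt_sn.
case: (posnP (size s)) => [/size0nil -> | s0].
  by rewrite phiw_nil deconc_word /decat !big_ord1 /= ?phiw_nil.
have dl := @deconc_linear K V.
rewrite {1}phiw_rec // (linmap_sum dl) big_ord_recl take0 drop0 phiw_nil.
under eq_bigr do rewrite (linmapZ dl) deconc_tcons scalerDr
   -(linmapZ (tpair_linr _)).
rewrite big_split /= -(linmap_sum (tpair_linr _)) -phiw_rec //; congr (_ + _).
have idl : linear (@id T) by [].
set N := size s.
pose E k j := a k.+1 *: (tcons (dotprod (take k.+1 s)) (phiw a (take j (drop k.+1 s)))
   *t phiw a (drop j (drop k.+1 s))).
transitivity (\sum_(k < N) \sum_(i < N | (k <= i)%N) E k (i - k)%N).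
  apply: eq_bigr => k _.
  have lt_k : (size (drop k.+1 s) < n)%N.
    by rewrite size_drop; apply: (@leq_trans N); rewrite // ltn_subrL s0.
  rewrite (IH _ lt_k) (linmap_sum (tmap_linear (tcons_linear _) idl)) scaler_sumr.
  rewrite size_drop subnSK //.
  under eq_bigr do rewrite (tmapE (tcons_linear _) idl).
  rewrite -(big_mkord xpredT (E k)) -(big_mkord (fun i => k <= i)%N (fun i => E k (i - k)%N)).
  rewrite [RHS](@big_cat_nat _ _ _ k) //= 1?ltnW //.
  rewrite [X in _ = X + _]big_nat_cond [X in _ = X + _]big1 ?add0r => [|i /andP[/andP[_ lt_ik] le_ki]]; last by move: (leq_trans lt_ik le_ki); rewrite ltnn.
  rewrite -[X in \sum_(X <= _ < N | _) _]add0n big_addn big_nat_cond [RHS]big_nat_cond.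
  by apply: eq_big => i; rewrite ?addnK // leq_addl.
rewrite (exchange_big_dep xpredT) //=; apply: eq_bigr => i _.
rewrite /bump /= add1n.
have lt_i : size (take i.+1 s) = i.+1 by rewrite size_take_min; apply/minn_idPl.
rewrite phiw_rec ?lt_i // (linmap_sum (tpair_linl _)).
rewrite (big_ord_widen _ (fun k => a k.+1 *: tcons (dotprod (take k.+1 (take i.+1 s)))
  (phiw a (drop k.+1 (take i.+1 s))) *t phiw a (drop i.+1 s)) (ltn_ord i)).
apply: eq_big => [k|k le_ki]; first by rewrite ltnS.
rewrite /E -(linmapZ (tpair_linl _)) drop_drop addnS subnK // take_takel //.
rewrite -{3}(subnK le_ki) -addnS -take_drop.
by [].
Qed.
End PhiRec.
End Products.

(* The data of a bialgebra; Sh(V) and QS(V) below satisfy the Hopf algebra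
   axioms, which need not be bundled to speak of morphisms between them. *)
Record hopf_data (K : fieldType) := HopfData {
  hcarrier :> lmodType K;
  hone : hcarrier;
  hmul : hcarrier -> hcarrier -> hcarrier;
  hcounit : hcarrier -> K;
  hcomul : hcarrier -> hcarrier *t hcarrier
}.

(* A morphism of Hopf algebras is a morphism of the underlying bialgebras;
   compatibility with the antipodes is then automatic. *)
Record hopf_morphism (K : fieldType) (H H' : hopf_data K) (f : H -> H') : Prop :=
  HopfMorphism {
    hopf_linear : linear f;
    hopf_one : f (hone H) = hone H';
    hopf_mul : forall x y, f (hmul x y) = hmul (f x) (f y);
    hopf_counit : forall x, hcounit (f x) = hcounit x;
    hopf_comul : forall x, hcomul (f x) = tmap f f (hcomul x)
  }.

Definition Sh (K : fieldType) (V : comNonunitalAlgType K) : hopf_data K :=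
  @HopfData K (tensalg V) (word [::]) (@shuffle K V)
    (@tcounit K V) (@deconc K V).

Definition QS (K : fieldType) (V : comNonunitalAlgType K) : hopf_data K :=
  @HopfData K (tensalg V) (word [::]) (@qshuffle K V)
    (@tcounit K V) (@deconc K V).

Section PowerSeries.
Variable K : fieldType.

(* K[[X]], a series being its sequence of coefficients. *)
Definition fps := nat -> K.

Definition fps1 : fps := fun n => (n == 0)%:R.
Definition fpsX : fps := fun n => (n == 1)%:R.
Definition fps_sub (f g : fps) : fps := fun n => f n - g n.
Definition fps_scale (c : K) (f : fps) : fps := fun n => c * f n.
Definition fps_mul (f g : fps) : fps :=
  fun n => \sum_(i < n.+1) f i * g (n - i)%N.
Definition fps_pow (f : fps) (k : nat) : fps := iter k (fps_mul f) fps1.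

(* f o g for g without constant term: g ^ k has no term of degree < k, so that
   only the k <= n contribute to the coefficient of X ^ n. *)
Definition fps_comp (f g : fps) : fps :=
  fun n => \sum_(k < n.+1) f k * fps_pow g k n.

Definition exp_series : fps := fun n => (n`!)%:R^-1.
Definition ln1p_series : fps :=
  fun n => if n is m.+1 then (-1) ^+ m / n%:R else 0.

Definition fps_exp (f : fps) : fps := fps_comp exp_series f.

Definition pow1p_series (c : K) : fps := fps_exp (fps_scale c ln1p_series).
End PowerSeries.

(* Main.v *)
Require Import Defs.
From HB Require Import structures.
From mathcomp Require Import all_boot all_algebra ring.

(* Scaling by e the product of V in the quasi-shuffle recursion gives the
   shuffle for e = 0 and the quasi-shuffle for e = 1. For words v and w, both
   phi (v *_e w) and phi v *_f phi w decompose along the prefixes of v and w: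
   the first with coefficients sum_k N_k a_k, where N_k counts with weight the
   words of length k in v *_e w, the second with coefficients f a_i a_j. Hence
   phi is multiplicative if these coefficients agree. When one prefix is a
   letter this reads (n + 1) a_(n+1) + e n a_n = f a_1 a_n, and by
   associativity the other cases follow. Conversely, projecting the product of
   1 and 1 ... 1 in T(K) to K gives back this recurrence, whose solutions are
   the four families of series. *)

Set Implicit Arguments.
Unset Strict Implicit.
Unset Printing Implicit Defensive.

Import GRing.Theory.
Local Open Scope ring_scope.

(** * The product of weight [e] *)

Section QuasiShuffle.
Variables (K : fieldType) (V : comNonunitalAlgType K) (e : K).
Local Notation T := (tensalg V).

Lemma tcons0l (u : T) : tcons 0 u = 0.
Proof. by rewrite (linmap0 (tcons_linl u)). Qed.

Fixpoint eshw (s : seq V) : seq V -> T :=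
  if s is a :: v then
    fix eshw_s t := if t is b :: w
      then tcons a (eshw v t) + tcons b (eshw_s w)
           + tcons (e *: dot a b) (eshw v w)
      else word (a :: v)
  else fun t => word t.

Lemma eshw_nil s : eshw s [::] = word s. Proof. by case: s. Qed.

Lemma eshwE a v b w :
  eshw (a :: v) (b :: w)
  = tcons a (eshw v (b :: w)) + tcons b (eshw (a :: v) w)
    + tcons (e *: dot a b) (eshw v w).
Proof. by []. Qed.

Lemma eshwC s t : eshw s t = eshw t s.
Proof.
elim: s t => [|a v IHs] t; first by rewrite eshw_nil.
elim: t => [|b w IHt]; first by rewrite eshw_nil.
by rewrite !eshwE !IHs IHt dotC [in RHS](addrC (tcons b _)).
Qed.

Lemma eshw_multilinear t : multilinear (eshw ^~ t).
Proof.
move=> s s' c x y; elim: s t => [|a v IHs] t; rewrite ?cat0s ?cat_cons.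
  elim: t => [|b w IHt]; first by rewrite !eshw_nil; exact: (word_multilinear [::]).
  rewrite !eshwE IHt !tcons_linear dot_linear scalerDr scalerA mulrC -scalerA.
  by rewrite !tcons_linl !lin2.
elim: t => [|b w IHt]; first by rewrite !eshw_nil; exact: (word_multilinear (a :: v)).
by rewrite !eshwE !IHs IHt !tcons_linear !lin2.
Qed.

Definition eshuffle (x y : T) : T := tlift (fun s => tlift (eshw s) y) x.

Lemma eshuffle_linl y : linear (eshuffle ^~ y).
Proof. exact: tlift2_linl eshwC eshw_multilinear y. Qed.
Lemma eshuffle_linr x : linear (eshuffle x).
Proof. exact: tlift2_linr eshwC eshw_multilinear x. Qed.
Lemma eshuffle_word s t : eshuffle (word s) (word t) = eshw s t.
Proof. exact: tlift2_word eshwC eshw_multilinear s t. Qed.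

Lemma eshuffle1l u : eshuffle (word [::]) u = u.
Proof.
move: u; apply: tensalg_ext => //; first exact: eshuffle_linr.
by move=> s; rewrite eshuffle_word.
Qed.

Lemma eshuffle1r u : eshuffle u (word [::]) = u.
Proof.
move: u; apply: (tensalg_ext (f := eshuffle^~ _) (g := id)) => //.
  exact: eshuffle_linl.
by move=> s; rewrite eshuffle_word eshw_nil.
Qed.

Lemma eshuffle_tcons a u b v :
  eshuffle (tcons a u) (tcons b v)
  = tcons a (eshuffle u (tcons b v)) + tcons b (eshuffle (tcons a u) v)
    + tcons (e *: dot a b) (eshuffle u v).
Proof.
move: u; apply: tensalg_ext.
- by move=> c x y; rewrite tcons_linear eshuffle_linl.
- by move=> c x y; rewrite !(tcons_linear, eshuffle_linl) !lin2.
move=> s; move: v; apply: tensalg_ext.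
- by move=> c x y; rewrite tcons_linear eshuffle_linr.
- by move=> c x y; rewrite !(tcons_linear, eshuffle_linr) !lin2.
by move=> t; rewrite !tcons_word !eshuffle_word eshwE.
Qed.

Lemma tcounit_eshw s t : tcounit (eshw s t) = (nilp s && nilp t)%:R.
Proof.
case: s t => [|a s] [|b t]; rewrite ?tcounit_word //.
have cD := linmapD (W := K^o) (@tcounit_linear K V).
by rewrite eshwE !cD !tcounit_tcons !addr0.
Qed.

(** * Weighted counts of the word lengths in a product *)

(* The recursion of [eshw] when each word is replaced by the value of [a] at
   its length. *)
Fixpoint qsc (m : nat) : nat -> (nat -> K) -> K :=
  if m is m'.+1 then
    fix qsc_m n a := if n is n'.+1
      then qsc m' n (a \o succn) + qsc_m n' (a \o succn)
           + e * qsc m' n' (a \o succn)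
      else a m
  else fun n a => a n.

Lemma qsc0 m a : qsc m 0 a = a m. Proof. by case: m. Qed.

Lemma qscS m n a :
  qsc m.+1 n.+1 a = qsc m n.+1 (a \o succn) + qsc m.+1 n (a \o succn)
                    + e * qsc m n (a \o succn).
Proof. by []. Qed.

(** A letter goes into one of the [n + 1] gaps of a word of length [n], or multiplies one of its [n]
    letters at weight [e]. *)
Lemma qsc1 n a : qsc 1 n a = n.+1%:R * a n.+1 + n%:R * e * a n.
Proof.
elim: n a => [|n IH] a; first by rewrite /= mul1r !mul0r addr0.
by rewrite qscS IH /=; ring.
Qed.

(** The three terms are those into which the sequence of [qsc_assoc] splits under a shift. *)
Lemma qsc_lin m n c a x y z : (forall k, a k = x k + y k + c * z k) ->
  qsc m n a = qsc m n x + qsc m n y + c * qsc m n z.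
Proof.
elim: m n a x y z => [|m IHm] n a x y z a_def; first exact: a_def.
elim: n a x y z a_def => [|n IHn] a x y z a_def; first exact: a_def.
have S_def k : (a \o succn) k = (x \o succn) k + (y \o succn) k + c * (z \o succn) k.
  exact: a_def.
rewrite !qscS (IHn _ _ _ _ S_def) !(IHm _ _ _ _ _ S_def); ring.
Qed.

(* Associativity, in the form x * (v * w) = (x * v) * w for a letter x. *)
Lemma qsc_assoc m n a :
  qsc m n (fun k => k.+1%:R * a k.+1 + k%:R * e * a k)
  = m.+1%:R * qsc m.+1 n a + m%:R * e * qsc m n a.
Proof.
elim: m n a => [|m IHm] n a; first by rewrite mul1r !mul0r addr0 qsc1.
elim: n a => [|n IHn] a; first by rewrite !qsc0.
have E i j : qsc i j ((fun k => k.+1%:R * a k.+1 + k%:R * e * a k) \o succn)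
    = qsc i j (fun k => k.+1%:R * (a \o succn) k.+1 + k%:R * e * (a \o succn) k)
      + qsc i j (a \o succn \o succn) + e * qsc i j (a \o succn).
  by apply: qsc_lin => k /=; ring.
rewrite qscS !E IHn !IHm !(qscS m.+1) !(qscS m n) /=; ring.
Qed.

Lemma qscZ m n c a z : (forall k, a k = c * z k) -> qsc m n a = c * qsc m n z.
Proof.
elim: m n a z => [|m IHm] n a z a_def; first exact: a_def.
elim: n a z a_def => [|n IHn] a z a_def; first exact: a_def.
have S_def k : (a \o succn) k = c * (z \o succn) k by exact: a_def.
rewrite !qscS (IHn _ _ S_def) !(IHm _ _ _ S_def); ring.
Qed.

(* The multiplicities of the letter-times-word products determine all others,
   by associativity. *)
Lemma qsc_mul (f : K) (a : nat -> K) :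
    [pchar K] =i pred0 ->
    (forall n, n.+2%:R * a n.+2 + n.+1%:R * e * a n.+1 = f * a 1 * a n.+1) ->
  forall m n, qsc m.+1 n.+1 a = f * a m.+1 * a n.+1.
Proof.
move=> charK rec; elim=> [|m IH] n; first by rewrite qsc1 rec.
have m0 : m.+2%:R != 0 :> K by rewrite ((pcharf0P _).1 charK).
apply: (mulfI m0); have := qsc_assoc m.+1 n.+1 a.
(* The recurrence is given only from index 1 on; unfolding [qsc] once shifts the sequence past index
   0. *)
have E i j : qsc i j ((fun k => k.+1%:R * a k.+1 + k%:R * e * a k) \o succn)
    = f * a 1 * qsc i j (a \o succn) by apply: qscZ => k /=; exact: rec.
rewrite qscS !E [e * _]mulrCA -!mulrDr -qscS IH.
move/esym/(canRL (addrK _)) => ->.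
have -> : m.+2%:R * (f * a m.+2 * a n.+1) = f * (m.+2%:R * a m.+2) * a n.+1 by ring.
by rewrite (canRL (addrK _) (rec m)); ring.
Qed.

(* The junk value [dotprod [::] = 0] makes the term i = j = 0 vanish when [p]
   is empty, so that no nonempty prefix has to be required. *)
Definition psum (c : nat -> nat -> K) (X : seq V -> seq V -> T) p v w : T :=
  \sum_(i < (size v).+1) \sum_(j < (size w).+1)
    c i j *: tcons (dotprod (p ++ take i v ++ take j w)) (X (drop i v) (drop j w)).

Local Arguments qsc : simpl never.

(** Off the axes this is the recursion of [qsc]. The rest of the row [i = 0] goes to the second sum,
    that of the column [j = 0] to the first. *)
Lemma sum_qsc (W : lmodType K) m n (a : nat -> K) (t : nat -> nat -> W) :
  \sum_(i < m.+2) \sum_(j < n.+2) qsc i j a *: t i j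
  = a 0 *: t 0 0 + \sum_(i < m.+1) \sum_(j < n.+2) qsc i j (a \o succn) *: t i.+1 j
    + \sum_(i < m.+2) \sum_(j < n.+1) qsc i j (a \o succn) *: t i j.+1
    + e *: \sum_(i < m.+1) \sum_(j < n.+1) qsc i j (a \o succn) *: t i.+1 j.+1.
Proof.
pose G i j := qsc i j a *: t i j.
rewrite (big_ord_recl m.+1) /= (big_ord_recl n.+1 (fun j => G 0 j)) /= -!addrA.
congr (_ + _); rewrite (big_ord_recl m.+1 (fun i => \sum_(j < n.+1) _)) /=.
rewrite -!addrA [RHS]addrCA; congr (_ + _).
rewrite scaler_sumr -!big_split /=; apply: eq_bigr => i _.
rewrite (big_ord_recl n.+1 (fun j => G (bump 0 i) j)) (big_ord_recl n.+1) /= -addrA.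
congr (_ + _); first by rewrite /G !qsc0.
rewrite scaler_sumr -!big_split /=; apply: eq_bigr => j _.
by rewrite /G /bump /= !add1n qscS !scalerDl scalerA addrA.
Qed.

Lemma dotprod_perm (s t : seq V) : perm_eq s t -> dotprod s = dotprod t.
Proof.
(* [V] has no unit; [None] serves as one, which makes the product a big operation of a commutative
   monoid. *)
have dE r : dotprod r =
    odflt 0 (\big[oAC (@dotA K V) (@dotC K V)/None]_(x <- r) Some x).
  case: r => [|x r] /=; first by rewrite big_nil.
  rewrite big_cons.
  elim: r x => [|y r IH] x; first by rewrite big_nil.
  rewrite big_cons Monoid.mulmA; exact: (IH (dot x y)).
by move=> st; rewrite !dE (perm_big _ st).
Qed.

Lemma dotprod_dot (p : seq V) x y s :
  dotprod (p ++ dot x y :: s) = dotprod (p ++ [:: x, y & s]).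
Proof.
by case: p => [|z p] //=; rewrite !foldl_cat /= dotA.
Qed.

Lemma dotprodZ c (p : seq V) x s : dotprod (p ++ c *: x :: s) = c *: dotprod (p ++ x :: s).
Proof. exact: (linmapZ (dotprod_linear p s)). Qed.

(** * Expansion of [phi a] of a product along prefixes *)

Section Phi.
Variable a : nat -> K.
Local Notation F v w := (phi a (eshw v w)).

(* [phi a] on a word whose first block has already absorbed the letters [p]; the
   coefficients of that block are those of the shifted sequence [b]. *)
Definition phipw (b : nat -> K) (p s : seq V) : T :=
  \sum_(k < (size s).+1) b k *: tcons (dotprod (p ++ take k s)) (phiw a (drop k s)).

Lemma phipw_cons b p x s :
  phipw b p (x :: s)
  = b 0 *: tcons (dotprod p) (phiw a (x :: s)) + phipw (b \o succn) (rcons p x) s.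
Proof.
rewrite /phipw big_ord_recl /= cats0; congr (_ + _).
by apply: eq_bigr => k _; rewrite cat_rcons.
Qed.

Lemma phipw_multilinear b p : multilinear (phipw b p).
Proof.
move=> s t c x y; rewrite /phipw !size_cat /= scaler_sumr -big_split /=.
apply: eq_bigr => k _; rewrite !take_cat !drop_cat; case: ltnP => [_|le_sk].
  by rewrite phiw_multilinear tcons_linear scalerDr !scalerA mulrC.
case: (k - size s)%N => [|n] /=.
  by rewrite (phiw_multilinear a [::]) tcons_linear scalerDr !scalerA mulrC.
by rewrite !catA dotprod_linear tcons_linl scalerDr !scalerA mulrC.
Qed.

Definition phip b p : T -> T := tlift (phipw b p).

Lemma phip_linear b p : linear (phip b p).
Proof. exact/tlift_linear/phipw_multilinear. Qed.

Lemma phip_word b p s : phip b p (word s) = phipw b p s.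
Proof. exact/tlift_word/phipw_multilinear. Qed.

Lemma phip_tcons b p x u :
  phip b p (tcons x u)
  = b 0 *: tcons (dotprod p) (phi a (tcons x u)) + phip (b \o succn) (rcons p x) u.
Proof.
move: u; apply: tensalg_ext.
- by move=> c u v; rewrite tcons_linear phip_linear.
- move=> c u v; rewrite !(tcons_linear, phi_linear, phip_linear).
  by rewrite scalerDr !scalerA (mulrC _ c) -scalerA lin2.
by move=> s; rewrite !(tcons_word, phip_word, phi_word) phipw_cons.
Qed.

(** When no letter is absorbed, the term [k = 0] vanishes with [dotprod [::]] and the recursion of
    [phiw] remains, except on the empty word, where the sum is 0 instead of the unit. *)
Lemma phip0 u : phip a [::] u = phi a u - tcounit u *: word [::].
Proof.
move: u; apply: tensalg_ext; first exact: phip_linear.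
  move=> c u v; rewrite phi_linear tcounit_linear scalerDl opprD addrACA.
  by rewrite scalerBr scalerA.
move=> [|x s]; rewrite phip_word phi_word tcounit_word /=.
  rewrite /phipw big_ord1 tcons0l phiw_nil scaler0 scale1r.
  by rewrite subrr.
by rewrite scale0r subr0 phipw_cons tcons0l scaler0 add0r [RHS]phiw_rec.
Qed.

(** Induction on both words. The first letter of the product, from [v], from [w] or from both, joins
    [p] while [b] is shifted, as in the recursion of [qsc]; commutativity of [V] reorders the
    absorbed letters. *)
Lemma phip_eshw b p v w :
  phip b p (eshw v w) = psum (fun i j => qsc i j b) (fun v w => F v w) p v w.
Proof.
elim: v w b p => [|x v IHv] w b p.
  rewrite /psum big_ord1 phip_word; apply: eq_bigr => j _.
  by rewrite take0 drop0 phi_word.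
elim: w b p => [|y w IHw] b p.
  rewrite eshw_nil phip_word; apply: eq_bigr => i _.
  by rewrite big_ord1 take0 drop0 cats0 eshw_nil phi_word qsc0.
set t := fun i j => tcons (dotprod (p ++ take i (x :: v) ++ take j (y :: w)))
            (F (drop i (x :: v)) (drop j (y :: w))).
rewrite [RHS](sum_qsc _ _ b t).
rewrite eshwE !(linmapD (phip_linear _ _)) !phip_tcons IHw !IHv.
(* The terms in [b 0], where the first block stops at [p], recombine to [phi a] of the whole
   product. *)
rewrite (addrACA (b 0 *: _)) [LHS]addrACA -!scalerDr -!(linmapD (tcons_linear _)).
rewrite -!(linmapD (phi_linear _)) -eshwE -!addrA.
congr (_ *: _ + _); first by rewrite /t /= cats0.
congr (_ + (_ + _)).
- apply: eq_bigr => i _; apply: eq_bigr => j _; rewrite /t /=.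
  by rewrite cat_rcons.
- apply: eq_bigr => i _; apply: eq_bigr => j _; rewrite /t /=.
  congr (_ *: tcons _ _); apply: dotprod_perm.
  by rewrite cat_rcons perm_cat2l; apply/permPl; exact: (perm_catCA [:: y]).
rewrite scaler_sumr; apply: eq_bigr => i _.
rewrite scaler_sumr; apply: eq_bigr => j _; rewrite /t /=.
rewrite cat_rcons dotprodZ (linmapZ (tcons_linl _)) /= !scalerA mulrC.
congr (_ *: tcons _ _); rewrite dotprod_dot; apply: dotprod_perm.
by rewrite perm_cat2l perm_cons; apply/permPl; exact: (perm_catCA [:: y]).
Qed.

Lemma phi_eshw v w : ~~ (nilp v && nilp w) ->
  F v w = psum (fun i j => qsc i j a) (fun v w => F v w) [::] v w.
Proof.
move=> vw; rewrite -phip_eshw phip0 tcounit_eshw (negbTE vw) /=.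
by rewrite scale0r subr0.
Qed.

(** A letter followed by a nonempty word projects to 0, and [phi a] preserves the counit, so only
    the term with both suffixes empty survives. *)
Lemma tproj_psum c p v w :
  tproj (psum c (fun v w => F v w) p v w)
  = c (size v) (size w) *: dotprod (p ++ v ++ w).
Proof.
rewrite (linmap_sum (@tproj_linear K V)) big_ord_recr big1 /= ?add0r => [|i _].
  rewrite (linmap_sum (@tproj_linear K V)) big_ord_recr big1 /= ?add0r => [|j _].
    rewrite (linmapZ (@tproj_linear K V)) tproj_tcons phi_counit tcounit_eshw.
    by rewrite !drop_size !take_size scale1r.
  rewrite (linmapZ (@tproj_linear K V)) tproj_tcons phi_counit tcounit_eshw.
  rewrite {2}/nilp size_drop subn_eq0 leqNgt ltn_ord andbF scale0r scaler0 //.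
rewrite (linmap_sum (@tproj_linear K V)) big1 // => j _.
rewrite (linmapZ (@tproj_linear K V)) tproj_tcons phi_counit tcounit_eshw.
by rewrite {1}/nilp size_drop subn_eq0 leqNgt ltn_ord scale0r scaler0.
Qed.

End Phi.
End QuasiShuffle.

(** * Expansion of a product of two values of [phi a] *)

Section ProductOfPhi.
Variables (K : fieldType) (V : comNonunitalAlgType K) (f : K) (a : nat -> K).

Lemma dotprod_cat x s y t :
  dotprod (x :: s ++ y :: t) = dot (dotprod (x :: s)) (dotprod (y :: t)) :> V.
Proof.
rewrite /= foldl_cat /=; elim: t y => //= z t IH y.
by rewrite -IH dotA.
Qed.

(** The first letter of the product is a block of one factor or, at weight [f], the product of a
    block of each. *)
Definition phic (i j : nat) : K :=
  if i is 0 then a j else if j is 0 then a i else f * a i * a j.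

(** The terms are arranged as the row [i = 0], the column [j = 0] and the interior of [psum]. *)
Lemma eshuffle_sum m n (X Y : nat -> V) (U W : nat -> tensalg V) b c P Q :
    P = \sum_(i < m) b i *: tcons (X i) (U i) ->
    Q = \sum_(j < n) c j *: tcons (Y j) (W j) ->
  eshuffle f P Q
  = \sum_(j < n) c j *: tcons (Y j) (eshuffle f P (W j))
  + \sum_(i < m) (b i *: tcons (X i) (eshuffle f (U i) Q)
  + \sum_(j < n) (f * b i * c j) *: tcons (dot (X i) (Y j)) (eshuffle f (U i) (W j))).
Proof.
move=> PE QE.
have sumr (u : tensalg V) :
    eshuffle f u Q = \sum_(j < n) c j *: eshuffle f u (tcons (Y j) (W j)).
  rewrite QE (linmap_sum (eshuffle_linr _ _)).
  by apply: eq_bigr => j _; rewrite (linmapZ (eshuffle_linr _ _)).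
have suml (u : tensalg V) :
    eshuffle f P u = \sum_(i < m) b i *: eshuffle f (tcons (X i) (U i)) u.
  rewrite PE (linmap_sum (eshuffle_linl _ _)).
  by apply: eq_bigr => i _; rewrite (linmapZ (eshuffle_linl _ _)).
have -> : \sum_(j < n) c j *: tcons (Y j) (eshuffle f P (W j))
   = \sum_(i < m) \sum_(j < n) (b i * c j) *:
       tcons (Y j) (eshuffle f (tcons (X i) (U i)) (W j)).
  rewrite exchange_big; apply: eq_bigr => j _ /=.
  rewrite suml (linmap_sum (tcons_linear _)) scaler_sumr; apply: eq_bigr => i _.
  by rewrite (linmapZ (tcons_linear _)) scalerA mulrC.
rewrite suml -big_split /=; apply: eq_bigr => i _.
rewrite !sumr (linmap_sum (tcons_linear _)) !scaler_sumr -!big_split /=.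
apply: eq_bigr => j _.
rewrite eshuffle_tcons (linmapZ (tcons_linl _)) (linmapZ (tcons_linear _)).
rewrite !scalerDr !scalerA addrCA addrA.
by congr (_ + _ *: _); ring.
Qed.

Lemma eshuffle_phi (v w : seq V) : ~~ nilp v -> ~~ nilp w ->
  eshuffle f (phiw a v) (phiw a w)
  = psum phic (fun v w => eshuffle f (phiw a v) (phiw a w)) [::] v w.
Proof.
case: v => // x v _; case: w => // y w _.
pose X s k : V := dotprod (take k.+1 s); pose U (s : seq V) k := phiw a (drop k.+1 s).
have phiE s : (0 < size s)%N ->
    phiw a s = \sum_(k < size s) a k.+1 *: tcons (X s k) (U s k) by exact: phiw_rec.
rewrite (eshuffle_sum (phiE (x :: v) isT) (phiE (y :: w) isT)).
rewrite /psum [RHS]big_ord_recl [X in _ = X + _]big_ord_recl /= tcons0l scaler0 add0r.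
congr (_ + _).
apply: eq_bigr => i _; rewrite [RHS]big_ord_recl /= cats0; congr (_ + _).
by apply: eq_bigr => j _; rewrite -dotprod_cat.
Qed.
End ProductOfPhi.

(** * Multiplicativity as a recurrence on the coefficients *)

Section Multiplicativity.
Variables (K : fieldType) (e f : K) (a : nat -> K).
Hypothesis charK : [pchar K] =i pred0.

(** When [a 0 = 0], this is the differential equation [(1 + e X) A' = a_1 (1 + f A)]. *)
Definition phi_recurrence :=
  forall n, n.+2%:R * a n.+2 + n.+1%:R * e * a n.+1 = f * a 1 * a n.+1.

(** Induction on the total length: the term with both prefixes empty vanishes, and in every other
    term the suffixes are shorter together. *)
Lemma phi_eshuffle (V : comNonunitalAlgType K) (x y : tensalg V) :
  phi_recurrence -> phi a (eshuffle e x y) = eshuffle f (phi a x) (phi a y).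
Proof.
move=> rec; have pl := @phi_linear K V a.
move: x; apply: tensalg_ext.
- by move=> c u v; rewrite eshuffle_linl pl.
- by move=> c u v; rewrite pl eshuffle_linl.
move=> v; move: y; apply: tensalg_ext.
- by move=> c u w; rewrite eshuffle_linr pl.
- by move=> c u w; rewrite pl eshuffle_linr.
move=> w; rewrite eshuffle_word !phi_word.
have [n] := ubnP (size v + size w); elim: n v w => // n IH v w.
rewrite ltnS => le_n; have [v0|v0] := boolP (nilp v).
  by rewrite (nilP v0) phiw_nil eshuffle1l phi_word.
have [w0|w0] := boolP (nilp w).
  by rewrite (nilP w0) eshw_nil phiw_nil eshuffle1r phi_word.
rewrite phi_eshw ?negb_and ?v0 // eshuffle_phi //.
apply: eq_bigr => i _; apply: eq_bigr => j _.
have [/andP[/eqP -> /eqP ->]|ij] := boolP ((i == 0 :> nat) && (j == 0 :> nat)).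
  by rewrite !take0 !tcons0l !scaler0.
rewrite IH; last first.
  apply: leq_trans le_n; rewrite !size_drop.
  move: ij; rewrite negb_and -!lt0n; move: v0 w0; rewrite /nilp -!lt0n.
  move=> sv sw /orP[i0|j0].
    by rewrite -addSn leq_add ?leq_subr // ltn_subrL i0.
  by rewrite -addnS leq_add ?leq_subr // ltn_subrL j0.
(* With an empty prefix both coefficients are the same value of [a]. *)
congr (_ *: _); case: (i : nat) (j : nat) => [|i'] [|j'] //.
exact: qsc_mul.
Qed.

(* In the algebra K itself no product 1 ... 1 vanishes. *)
HB.instance Definition _ := isComNonunitalAlgebra.Build K K^o
  (@mulrA K) (@mulrC K) (fun y c x x' =>
    etrans (mulrDl (c * x) x' y) (congr1 (+%R^~ (x' * y)) (esym (mulrA c x y)))).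

Lemma phi_eshuffle_recurrence :
  (forall x y : tensalg K^o, phi a (eshuffle e x y) = eshuffle f (phi a x) (phi a y)) ->
  phi_recurrence.
Proof.
move=> phiM n; pose v : seq K^o := [:: 1]; pose w : seq K^o := nseq n.+1 1.
have E s t : eshuffle f (phiw a s) (phiw a t) = phi a (eshw e s t) :> tensalg K^o.
  by rewrite -!phi_word -phiM eshuffle_word.
(* Multiplicativity identifies the suffix terms, so the two expansions differ only in their
   coefficients. *)
have : psum (fun i j => qsc e i j a) (fun v w => phi a (eshw e v w)) [::] v w
    = psum (phic f a) (fun v w => phi a (eshw e v w)) [::] v w.
  rewrite -phi_eshw // -E eshuffle_phi //.
  by apply: eq_bigr => i _; apply: eq_bigr => j _; rewrite E.
move/(congr1 (@tproj K K^o)); rewrite !tproj_psum size_nseq qsc1.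
have dot11 : dot (1 : K^o) (1 : K^o) = 1 by exact: mulr1.
have -> : dotprod ([::] ++ v ++ w) = 1.
  by rewrite /= dot11; elim: n {w} => //= n IH; rewrite dot11.
by move/(mulIf (oner_neq0 K)).
Qed.

(** [phi a] is always a counital coalgebra map, so only its multiplicativity is in question. *)
Lemma hopf_morphism_phi (m m' : forall V : comNonunitalAlgType K,
      tensalg V -> tensalg V -> tensalg V) :
    (forall V : comNonunitalAlgType K, @m V =2 eshuffle e) ->
    (forall V : comNonunitalAlgType K, @m' V =2 eshuffle f) ->
  (forall V : comNonunitalAlgType K, hopf_morphism
    (phi a : HopfData (word [::]) (@m V) (@tcounit K V) (@deconc K V) ->
             HopfData (word [::]) (@m' V) (@tcounit K V) (@deconc K V)))
  <-> phi_recurrence.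
Proof.
move=> mE m'E; split=> [mor|rec V].
  apply: phi_eshuffle_recurrence => x y.
  by rewrite -mE -m'E; exact: (hopf_mul (mor K^o)).
split=> /=.
- exact: phi_linear.
- by rewrite phi_word phiw_nil.
- by move=> x y; rewrite mE m'E; exact: phi_eshuffle.
- exact: phi_counit.
- exact: phi_comul.
Qed.
End Multiplicativity.

Lemma shuffleE (K : fieldType) (V : comNonunitalAlgType K) :
  @shuffle K V =2 eshuffle 0.
Proof.
move=> x y; move: x; apply: tensalg_ext.
- exact: shuffle_linl.
- exact: eshuffle_linl.
move=> s; move: y; apply: tensalg_ext; [exact: shuffle_linr|exact: eshuffle_linr|].
move=> t; rewrite shuffle_word eshuffle_word.
elim: s t => // x v IHv; elim=> // y w IHw.
by rewrite shwE eshwE scale0r tcons0l addr0 IHw IHv.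
Qed.

Lemma qshuffleE (K : fieldType) (V : comNonunitalAlgType K) :
  @qshuffle K V =2 eshuffle 1.
Proof.
move=> x y; move: x; apply: tensalg_ext.
- exact: qshuffle_linl.
- exact: eshuffle_linl.
move=> s; move: y; apply: tensalg_ext; [exact: qshuffle_linr|exact: eshuffle_linr|].
move=> t; rewrite qshuffle_word eshuffle_word.
elim: s t => // x v IHv; elim=> // y w IHw.
by rewrite qshwE eshwE scale1r IHw !IHv.
Qed.

(** * Power series solving the recurrence *)

Section Series.
Variables (K : fieldType).
Hypothesis charK : [pchar K] =i pred0.

Lemma natS_neq0 n : n.+1%:R != 0 :> K.
Proof. by rewrite ((pcharf0P _).1 charK). Qed.

(** As [n + 2] is invertible, the recurrence determines a series from its first two coefficients, so
    a family of solutions with every value of [a_1] exhausts them. *)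
Lemma recurrence_iff e f (A : fps K) (B : K -> fps K) : A 0 = 0 ->
    (forall c, B c 0 = 0) -> (forall c, B c 1 = c) ->
    (forall c, phi_recurrence e f (B c)) ->
  phi_recurrence e f A <-> exists c, A =1 B c.
Proof.
move=> A0 B0 B1 Brec; split=> [Arec|[c AB] n]; last by rewrite !AB Brec.
exists (A 1); elim/ltn_ind=> -[|[|n]] IH; rewrite ?A0 ?B0 ?B1 //.
apply: (mulfI (natS_neq0 n.+1)).
rewrite (canRL (addrK _) (Arec n)) (canRL (addrK _) (Brec (A 1) n)) B1.
by rewrite (IH n.+1).
Qed.

Lemma fps_pow_scaleX (c : K) k n :
  fps_pow (fps_scale c (fpsX K)) k n = c ^+ k * (n == k)%:R.
Proof.
elim: k n => [|k IH] n; first by rewrite mul1r.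
rewrite /= /fps_mul; case: n => [|n].
  by rewrite big_ord1 /fps_scale /fpsX /= mulr0 mul0r mulr0.
rewrite 2!big_ord_recl big1 => [|i _].
  by rewrite /fps_scale /fpsX /= mulr0 mul0r add0r addr0 mulr1 subSS subn0 IH exprS mulrA.
by rewrite /fps_scale /fpsX /= mulr0 mul0r.
Qed.

Lemma fps_exp_scaleX (c : K) n :
  fps_exp (fps_scale c (fpsX K)) n = c ^+ n / n`!%:R.
Proof.
rewrite /fps_exp /fps_comp big_ord_recr big1 /= => [|i _].
  by rewrite fps_pow_scaleX eqxx mulr1 add0r mulrC.
by rewrite fps_pow_scaleX gtn_eqF ?ltn_ord // !mulr0.
Qed.

Lemma fps_pow_lt (g : fps K) k n : g 0 = 0 -> (n < k)%N -> fps_pow g k n = 0.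
Proof.
move=> g0; elim: k n => // k IH n lt_nk; rewrite /= /fps_mul big_ord_recl g0 mul0r add0r.
apply: big1 => i _; rewrite IH ?mulr0 //.
by rewrite (@leq_trans n) // ltn_subrL (leq_ltn_trans _ (ltn_ord i)).
Qed.

(** Coefficients below [N] see only the truncation, which gives access to polynomial derivatives. *)
Lemma fps_pow_poly (g : fps K) N k n : (n < N)%N ->
  fps_pow g k n = ((\poly_(i < N) g i) ^+ k)`_n.
Proof.
elim: k n => [|k IH] n lt_nN; first by rewrite expr0 coef1.
rewrite exprS coefM [LHS]/(fps_mul g (fps_pow g k) n).
apply: eq_bigr => -[i i_le] _ /=.
by rewrite coef_poly (leq_trans i_le lt_nN) IH // (leq_ltn_trans (leq_subr _ _)).
Qed.

(* The differential equation (1 + X) B' = c B of B = (1 + X)^c, for the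
   polynomial truncation of B. *)
Lemma pow1p_series_rec (c : K) n :
  n.+1%:R * pow1p_series c n.+1 + n%:R * pow1p_series c n = c * pow1p_series c n.
Proof.
pose g : fps K := fps_scale c (@ln1p_series K).
have g0 : g 0 = 0 by exact: mulr0.
(* The coefficient of degree [n + 1] is kept because the derivative lowers degrees by one. *)
pose G := \poly_(i < n.+2) g i.
pose B := \sum_(k < n.+2) k`!%:R^-1 *: G ^+ k.
have BE i : (i < n.+2)%N -> pow1p_series c i = B`_i.
  move=> lt_i; rewrite coef_sum.
  rewrite /pow1p_series /fps_exp /fps_comp (big_ord_widen _ (fun k => _ k * _ k i) lt_i).
  rewrite big_mkcond /=; apply: eq_bigr => k _; rewrite coefZ -fps_pow_poly //.
  by case: ltnP => // lt_ik; rewrite fps_pow_lt ?mulr0.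
(* Differentiating the truncated exponential [B] loses its last term, a multiple of [G ^+ n.+1],
   which has no coefficient in degree [n]. *)
pose R := \sum_(k < n.+1) k`!%:R^-1 *: G ^+ k.
have B'E : B^`() = G^`() * R.
  rewrite raddf_sum big_ord_recl /= expr0 derivZ derivC scaler0 add0r mulr_sumr.
  apply: eq_bigr => k _; rewrite derivZ deriv_exp /= -scaler_nat scalerA.
  rewrite /bump add1n factS natrM invfM mulrAC mulVf ?natS_neq0 // mul1r.
  by rewrite scalerAr.
have Rn : R`_n = B`_n.
  rewrite /B big_ord_recr coefD coefZ -fps_pow_poly // fps_pow_lt //.
  by rewrite mulr0 addr0.
(* Up to the truncation, [(1 + X) ln(1 + X)' = 1]. *)
have GE i : (i < n.+1)%N -> ((1 + 'X) * G^`())`_i = c * (i == 0)%:R.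
  move=> lt_i; rewrite mulrDl mul1r coefD coefXM !coef_deriv !coef_poly ltnS lt_i.
  case: i lt_i => [|i] lt_i /=.
    by rewrite addr0 mulr1 /g /fps_scale /ln1p_series expr0 divr1 mulr1 mulr1n.
  rewrite ltnW // /g /fps_scale /ln1p_series mulr0.
  rewrite -![(c * _) *+ _]mulr_natr -!mulrA.
  by rewrite !mulVf ?natS_neq0 // !mulr1 exprS mulN1r mulrN addNr.
have : ((1 + 'X) * B^`())`_n = c * B`_n.
  rewrite B'E mulrA coefM big_ord_recl big1 => [|i _]; rewrite GE ?mulr1 ?subn0 ?Rn ?addr0 //.
  by rewrite mulr0 mul0r.
rewrite mulrDl mul1r coefD coefXM !coef_deriv !BE // => <-.
rewrite mulr_natl; congr (_ + _); case: (n) => [|m]; first by rewrite mul0r.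
by rewrite mulr_natl.
Qed.

Lemma pow1p_series0 (c : K) : pow1p_series c 0 = 1.
Proof.
by rewrite /pow1p_series /fps_exp /fps_comp big_ord1 /= /exp_series /fps1 fact0 invr1 mulr1.
Qed.

End Series.

Theorem proposition35 (K : fieldType) (charK : [pchar K] =i pred0)
    (A : fps K) (A0 : A 0%N = 0) :
  [/\ (forall V : comNonunitalAlgType K,
         hopf_morphism (phi A : Sh V -> Sh V))
      <-> (exists a : K, A =1 fps_scale a (fpsX K)),
      (forall V : comNonunitalAlgType K,
         hopf_morphism (phi A : Sh V -> QS V))
      <-> (exists a : K,
             A =1 fps_sub (fps_exp (fps_scale a (fpsX K))) (fps1 K)),
      (forall V : comNonunitalAlgType K,
         hopf_morphism (phi A : QS V -> QS V))
      <-> (exists a : K, A =1 fps_sub (pow1p_series a) (fps1 K)) &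
      (forall V : comNonunitalAlgType K,
         hopf_morphism (phi A : QS V -> Sh V))
      <-> (exists a : K, A =1 fps_scale a (ln1p_series K))].
Proof.
have n0 := natS_neq0 charK.
split.
(* Here [A' = a_1]. *)
- apply: (iff_trans (hopf_morphism_phi A charK (@shuffleE K) (@shuffleE K))).
  apply: recurrence_iff => // [c|c|c n]; rewrite /fps_scale /fpsX /=.
  + exact: mulr0.
  + exact: mulr1.
  + by ring.
(* Here [A' = a_1 (1 + A)]. *)
- apply: (iff_trans (hopf_morphism_phi A charK (@shuffleE K) (@qshuffleE K))).
  apply: recurrence_iff => // [c|c|c n]; rewrite /fps_sub /fps1 !fps_exp_scaleX /=.
  + by rewrite fact0 divr1 subrr.
  + by rewrite factS fact0 divr1 subr0.
  + rewrite mulr0 mul0r addr0 !subr0 mul1r [1`!]factS fact0 divr1 expr1 (factS n.+1) natrM.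
    have f0 : (n.+1)`!%:R != 0 :> K by case: (n.+1)`! (fact_gt0 n.+1).
    by rewrite (exprS _ n.+1); field; rewrite f0 -(natrD _ 2) n0.
(* Here [(1 + X) A' = a_1 (1 + A)]. *)
- apply: (iff_trans (hopf_morphism_phi A charK (@qshuffleE K) (@qshuffleE K))).
  have p1 (c : K) : pow1p_series c 1 = c.
    by have := pow1p_series_rec charK c 0; rewrite pow1p_series0 mul1r mul0r addr0 mulr1.
  apply: recurrence_iff => // [c|c|c n]; rewrite /fps_sub /fps1 /=.
  + by rewrite pow1p_series0 subrr.
  + by rewrite subr0 p1.
  + by rewrite !subr0 p1 mulr1 mul1r pow1p_series_rec.
(* Here [(1 + X) A' = a_1]. *)
- apply: (iff_trans (hopf_morphism_phi A charK (@qshuffleE K) (@shuffleE K))).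
  apply: recurrence_iff => // [c|c|c n]; rewrite /fps_scale /ln1p_series /=.
  + exact: mulr0.
  + by rewrite divr1 mulr1.
  + by rewrite exprS; field; rewrite nat1r -(natrD _ 2) !n0 oner_neq0.
Qed.
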